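(* If $\mathfrak{L}$ is a finite-dimensional semi-simple left Leibniz algebra over a field of characteristic zero, then $C^r(\mathfrak{L})=0$.
   Context: A left Leibniz algebra over a field $\mathbb{F}$ is an $\mathbb{F}$-vector space $\mathfrak{L}$ with a bilinear multiplication satisfying $x(yz)=(xy)z+y(xz)$ for all $x,y,z\in\mathfrak{L}$. Ideals are two-sided. The Leibniz kernel is the ideal $\mathrm{Leib}(\mathfrak{L}):=\langle x^2\mid x\in\mathfrak{L}\rangle_{\mathbb{F}}$ (the linear span of all squares). $\mathfrak{L}$ is semi-simple if $\mathrm{Leib}(\mathfrak{L})$ contains every solvable ideal of $\mathfrak{L}$. The right center is $C^r(\mathfrak{L}):=\{c\in\mathfrak{L}\mid\forall\,x\in\mathfrak{L}:xc=0\}$. *)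

(* Defs.v *)
From mathcomp Require Import all_boot all_order all_algebra.
Set Implicit Arguments.
Unset Strict Implicit.
Unset Printing Implicit Defensive.
Import GRing.Theory.
Local Open Scope ring_scope.

(* An algebra is a finite-dimensional vector space L together with a bilinear
   multiplication mul. *)
Section LeibnizAlgebra.
Variables (F : fieldType) (L : vectType F) (mul : {bilinear L -> L -> L}).
Implicit Types (U V W I : {vspace L}).

Definition left_leibniz : Prop :=
  forall x y z, mul x (mul y z) = mul (mul x y) z + mul y (mul x z).

(* A finite-dimensional span is described by bases, as for prodv in falgebra;
   lprodvP shows that it is the span of all products. *)
Definition lprodv U V : {vspace L} :=
  <<[seq mul u v | u <- vbasis U, v <- vbasis V]>>%VS.

Definition leibniz_ideal I : Prop :=
  forall x u, u \in I -> mul x u \in I /\ mul u x \in I.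

Fixpoint derived_series I n : {vspace L} :=
  if n is n'.+1 then lprodv (derived_series I n') (derived_series I n') else I.

Definition leibniz_solvable I : Prop := exists n, derived_series I n = 0%VS.

(* The set of squares may be infinite: x is in its linear span when it is a
   linear combination of finitely many squares. *)
Definition leibniz_kernel (x : L) : Prop :=
  exists s : seq L, x \in <<[seq mul y y | y <- s]>>%VS.

Definition leibniz_semisimple : Prop :=
  forall I, leibniz_ideal I -> leibniz_solvable I ->
  forall x, x \in I -> leibniz_kernel x.

Definition right_center (c : L) : Prop := forall x, mul x c = 0.

Lemma lprodvP U V W :
  reflect (forall u v, u \in U -> v \in V -> mul u v \in W) (lprodv U V <= W)%VS.
Proof.
apply: (iffP span_subvP) => [UVW u v /coord_vbasis-> /coord_vbasis-> | UVW].
  rewrite linear_sumlz memv_suml //= => i _; rewrite linear_sumr memv_suml //= => j _.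
  by rewrite linearZl_LR linearZr_LR !memvZ // UVW // allpairs_f ?mem_nth ?size_tuple.
move=> _ /allpairsP[[u v] /= [Uu Vv ->]].
by apply: UVW; apply: vbasis_mem.
Qed.

End LeibnizAlgebra.

(* Main.v *)
(** An element [c] killed by all left multiplications lies in the Leibniz kernel, hence
    in the span of all products; so it is enough to show that the span of all products
    contains no nonzero invariant vector.  This is a fragment of Weyl's theorem for the
    Lie algebra [G] of left multiplications: a Casimir element of [G] kills [c] but has
    nonzero trace, so its Fitting idempotent cuts out a smaller submodule containing [c].
    The submodule is kept as an idempotent matrix [e] commuting with [G], and one descends
    on the rank of [e].  For the Casimir element of [e G] one needs the trace form on [e G]
    to be nondegenerate.  Its radical comes from an ideal of the Leibniz algebra; ideals
    have perfect image in [G], and a perfect Lie algebra of matrices with zero trace form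
    is zero (Cartan's criterion, by Engel's theorem and the eigenvalue argument over a
    splitting field). *)

From HB Require Import structures.
Require Import Defs.
From mathcomp Require Import all_boot all_order all_algebra all_field.
From mathcomp Require Import boolp ring.
Set Implicit Arguments.
Unset Strict Implicit.
Unset Printing Implicit Defensive.
Import Order.TTheory GRing.Theory Num.Theory FalgLfun passmx.
Local Open Scope ring_scope.

(** * Descending chains and Engel's theorem *)

Lemma descending_chain_stable (F : fieldType) (V : vectType F)
    (f : nat -> {vspace V}) :
  (forall k, f k.+1 <= f k)%VS -> exists k, f k.+1 = f k.
Proof.
move=> f_dec; apply: contrapT => no_stab.
have dimf k : (\dim (f k) + k <= \dim (f 0%N))%N.
  elim: k => [|k IHk]; first by rewrite addn0.
  apply: leq_trans IHk; rewrite addnS ltn_add2r ltnNge; apply/negP => le_dim.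
  by apply: no_stab; exists k; apply/eqP; rewrite eqEdim f_dec.
by have := leq_trans (leq_addl _ _) (dimf (\dim (f 0)).+1); rewrite ltnn.
Qed.

Section Commutator.
Variables (R : comNzRingType) (A : algType R).

(** Made bilinear below so that [lprodv] yields derived Lie algebras. *)
Definition commutator (x y : A) := x * y - y * x.

Fact commutator_is_bilinear :
  bilinear_for (GRing.Scale.Law.clone _ _ *:%R _) (GRing.Scale.Law.clone _ _ *:%R _)
    commutator.
Proof.
split=> [y a x x'|x a y y'] /=; rewrite /commutator.
  by rewrite mulrDl mulrDr -scalerAl -scalerAr scalerBr addrACA opprD.
by rewrite mulrDr mulrDl -scalerAl -scalerAr scalerBr addrACA opprD.
Qed.
HB.instance Definition _ := bilinear_isBilinear.Build R A A A _ _ commutator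
  commutator_is_bilinear.

Lemma commutatorM_idem (e x y : A) : e * e = e -> GRing.comm e x -> GRing.comm e y ->
  commutator (e * x) (e * y) = e * commutator x y.
Proof.
move=> ee ex ey; rewrite /commutator mulrBr !mulrA -(mulrA e x e) -ex.
by rewrite -(mulrA e y e) -ey !mulrA ee.
Qed.

End Commutator.

Lemma lprodvS (F : fieldType) (L : vectType F) (mul : {bilinear L -> L -> L})
    (U U' V V' : {vspace L}) :
  (U <= U')%VS -> (V <= V')%VS -> (lprodv mul U V <= lprodv mul U' V')%VS.
Proof.
move=> sU sV; apply/lprodvP => u v uU vV.
by have /lprodvP := subvv (lprodv mul U' V'); apply; [apply: (subvP sU)|apply: (subvP sV)].
Qed.

Lemma memv_lprodv (F : fieldType) (L : vectType F) (mul : {bilinear L -> L -> L})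
    (U V : {vspace L}) u v : u \in U -> v \in V -> mul u v \in lprodv mul U V.
Proof. by have /lprodvP := subvv (lprodv mul U V); apply. Qed.

Section Engel.
Variables (F : fieldType) (A : falgType F).
Implicit Types (S T W : {vspace A}) (x : A).

(** Together with [absorb_nil], this turns nilpotency of [T] into a condition without exponents:
    only [W = 0] satisfies [T W = W]. *)
Lemma nil_absorb T W k : (T ^+ k = 0 -> T * W = W -> W = 0)%VS.
Proof.
move=> Tk0 TW; suffices <-: (T ^+ k * W = W)%VS by rewrite Tk0 prod0v.
by elim: k {Tk0} => [|k IHk]; rewrite ?prod1v // expvSr -prodvA TW.
Qed.

(** The chain [T ^+ k * fullv] stabilizes at some [W] with [T W = W], hence at zero. *)
Lemma absorb_nil T : (forall W, T * W = W -> W = 0)%VS ->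
  exists k, (T ^+ k = 0)%VS.
Proof.
move=> T_abs; have [k|k] :=
  @descending_chain_stable _ _ (fun k => T ^+ k * fullv)%VS _.
  elim: k => [|k IHk]; first by rewrite expv0 prod1v subvf.
  by rewrite (expvSl _ k.+1) [X in (_ <= X * _)%VS]expvSl -!prodvA prodvSr.
rewrite expvSl -prodvA => /T_abs Tk0; exists k; apply/eqP.
by rewrite -subv0 -Tk0 -[X in (X <= _)%VS]prodv1 prodvSr ?subvf.
Qed.

(* If W = (T + <x>) W then T W is stable under x, so W = T W + x^k W for all k,
   whence W = T W. *)
Lemma nil_add_normalizer T x k p : (T ^+ k = 0)%VS -> x ^+ p = 0 ->
    (forall t, t \in T -> commutator x t \in T) ->
  exists m, ((T + <[x]>) ^+ m = 0)%VS.
Proof.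
move=> Tk0 xp0 xT; apply: absorb_nil => W defW.
apply: (nil_absorb Tk0); apply/eqP.
have TxW : (T * W + <[x]> * W = W)%VS by rewrite -prodvDl.
have sTW : (T * W <= W)%VS by rewrite -[X in (_ <= X)%VS]TxW addvSl.
have sxW : (<[x]> * W <= W)%VS by rewrite -[X in (_ <= X)%VS]TxW addvSr.
have sxT : (<[x]> * T <= T * <[x]> + T)%VS.
  apply/prodvP => _ t /vlineP[a ->] Tt; rewrite -scalerAl memvZ //.
  have -> : x * t = t * x + commutator x t by rewrite addrC subrK.
  by rewrite memv_add ?xT // memv_mul ?memv_line.
have sxTW : (<[x]> * (T * W) <= T * W)%VS.
  rewrite prodvA (subv_trans (prodvSl _ sxT)) // prodvDl subv_add -prodvA.
  by rewrite prodvSr ?subvv.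
rewrite eqEsubv sTW /=.
suffices sWm m : (W <= T * W + <[x ^+ m]> * W)%VS.
  by have := sWm p; rewrite xp0 (_ : <[0]> = 0)%VS ?prod0v ?addv0 //;
     apply/eqP; rewrite -subv0 -memvE mem0v.
elim: m => [|m IHm]; first by rewrite expr0 -[<[1]>%VS]/1%VS prod1v addvSr.
rewrite -{1}TxW subv_add addvSl (subv_trans (prodvSr _ IHm)) //.
by rewrite prodvDr addvS // exprS -prodv_line -prodvA.
Qed.

(** The spaces of iterated commutators [[..[S, T], .., T]] reach 0 because [T] is nilpotent, so they
    end up inside [T]. In the one just before the first contained in [T], any element outside [T]
    normalizes [T]. *)
Lemma nil_normalizer_grows S T k : (T ^+ k = 0)%VS -> (T <= S)%VS -> ~~ (S <= T)%VS ->
    (forall s t, s \in S -> t \in T -> commutator s t \in S) ->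
  exists2 x, x \in S & x \notin T /\ forall t, t \in T -> commutator x t \in T.
Proof.
move=> Tk0 sTS nST ST.
pose Mk := fix Mk j := if j is j'.+1 then (T * Mk j' + Mk j' * T)%VS else fullv.
pose Sk := fix Sk j := if j is j'.+1 then lprodv (@commutator _ A) (Sk j') T else S.
have sSkS j : (Sk j <= S)%VS.
  elim: j => //= j IHj; apply/lprodvP => s t /(subvP IHj); exact: ST.
have sSkMk j : (Sk j <= Mk j)%VS.
  elim: j => [|j IHj] /=; first exact: subvf.
  apply/lprodvP => s t /(subvP IHj) Ms Tt; rewrite /= /commutator addrC memv_add //.
    by rewrite memvN memv_mul.
  by rewrite memv_mul.
have [j Mj0] : exists j, Mk j = 0%VS.
  have [j|j Mj] := @descending_chain_stable _ _ Mk.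
    elim: j => [|j IHj]; first exact: subvf.
    by rewrite [X in (_ <= X)%VS]/= addvS ?prodvSl ?prodvSr.
  exists j; move: Mj => /=; move: (Mk j) => W defW.
  (* From [W = T W + W T] one gets [W T^m = T W T^m + W T^(m+1)]; so if [W T^(m+1) = 0], then [T]
     absorbs [W T^m], which is therefore zero. *)
  suffices WT0 m : (W * T ^+ m = 0 -> W = 0)%VS by apply: (WT0 k); rewrite Tk0 prodv0.
  elim: m => [|m IHm] WTm0; first by rewrite -[LHS]prodv1.
  apply: IHm; apply: (nil_absorb Tk0).
  by rewrite -{2}defW prodvDl -!prodvA -expvSl WTm0 addv0.
have exj : exists j, (Sk j <= T)%VS.
  by exists j; rewrite (subv_trans (sSkMk j)) // Mj0 sub0v.
case: (ex_minnP exj) => -[|i] //= sSi min_i; first by rewrite sSi in nST.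
have /subvPn[x Si_x Tx] : ~~ (Sk i <= T)%VS.
  by apply/negP => /min_i; rewrite ltnn.
exists x; first exact: (subvP (sSkS i)).
by split=> // t Tt; apply: (subvP sSi); apply: memv_lprodv.
Qed.

(** A nilpotent Lie subalgebra [T] of [S] is enlarged by an element normalizing it, which
    [nil_normalizer_grows] provides; the induction is on the codimension of [T] in [S]. *)
Theorem engel S : (forall x y, x \in S -> y \in S -> commutator x y \in S) ->
    (forall x, x \in S -> exists p, x ^+ p = 0) ->
  exists k, (S ^+ k = 0)%VS.
Proof.
move=> S_lie S_nil.
suffices grow d T k : (\dim S - \dim T <= d)%N -> (T <= S)%VS -> (T ^+ k = 0)%VS ->
    (forall x y, x \in T -> y \in T -> commutator x y \in T) ->
  exists k, (S ^+ k = 0)%VS.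
  apply: (grow (\dim S) 0%VS 1%N) => [||//|x y]; rewrite ?dimv0 ?subn0 ?sub0v //.
  by rewrite !memv0 => /eqP-> _; rewrite /commutator mul0r mulr0 subrr.
elim: d T k => [|d IHd] T k le_d sTS Tk0 T_lie.
  have /eqP <- : (T == S)%VS by rewrite eqEdim sTS -subn_eq0 -leqn0.
  by exists k.
have [sST|nST] := boolP (S <= T)%VS.
  by have -> : S = T; [apply/eqP; rewrite eqEsubv sST | exists k].
have [|x Sx [nTx xT]] := nil_normalizer_grows Tk0 sTS nST.
  by move=> s t Ss /(subvP sTS); apply: S_lie.
have [p xp0] := S_nil x Sx.
have [m Txm0] := nil_add_normalizer Tk0 xp0 xT.
have sTx : (T <= T + <[x]>)%VS := addvSl _ _.
have sTxS : (T + <[x]> <= S)%VS by rewrite subv_add sTS.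
apply: (IHd _ m) Txm0 _ => //.
  have ltT : (\dim T < \dim (T + <[x]>))%N.
    rewrite ltnNge; apply: contra nTx => le_dim.
    have /eqP-> : (T == T + <[x]>)%VS by rewrite eqEdim sTx.
    by rewrite (subvP (addvSr T <[x]>)) ?memv_line.
  by rewrite -ltnS (leq_trans _ le_d) // ltn_sub2l // (leq_trans ltT) ?dimvS.
move=> _ _ /memv_addP[t Tt [_ /vlineP[a ->] ->]] /memv_addP[u Tu [_ /vlineP[b ->] ->]].
apply: (subvP sTx); rewrite linearDl !linearDr /=.
have xx0 : commutator x x = 0 by rewrite /commutator subrr.
have tx y : y \in T -> commutator y x \in T.
  by move=> Ty; rewrite -memvN /commutator opprB xT.
rewrite !linearZl_LR !linearZr_LR /= xx0 !scaler0 addr0.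
exact: rpredD (rpredD (T_lie _ _ Tt Tu) (memvZ _ (tx _ Tt))) (memvZ _ (xT _ Tu)).
Qed.

(** Perfectness gives [S <= S * S], so [S] lies in all its positive powers, and Engel's theorem
    makes one of them zero. *)
Corollary perfect_nil_eq0 S : lprodv (@commutator _ A) S S = S ->
    (forall x, x \in S -> exists p, x ^+ p = 0) -> S = 0%VS.
Proof.
move=> perfS S_nil; have [|k Sk0] := engel _ S_nil.
  by move=> x y Sx Sy; rewrite -perfS memv_lprodv.
have sSSS : (S <= S * S)%VS.
  rewrite -{1}perfS; apply/lprodvP => x y Sx Sy.
  by rewrite rpredB ?memv_mul.
suffices sSm m : (S <= S ^+ m.+1)%VS.
  by apply/eqP; rewrite -subv0 (subv_trans (sSm k)) // expvSl Sk0 prodv0.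
elim: m => [|m IHm]; first by rewrite expv1.
by rewrite expvSl (subv_trans sSSS) // prodvSr.
Qed.

End Engel.

(** * Polynomial congruences and traces *)

Section PolynomialCRT.
Variable K : fieldType.
Implicit Types (s : seq K) (p : {poly K}).

Lemma coprimep_XsubC_exp_prod (a : K) s N : a \notin s ->
  coprimep (('X - a%:P) ^+ N) (\prod_(b <- s) ('X - b%:P) ^+ N).
Proof.
elim: s => [|b s IHs]; first by rewrite big_nil coprimep1.
rewrite inE negb_or => /andP[neq_ab nsa]; rewrite big_cons coprimepMr IHs // andbT.
by rewrite coprimep_expl // coprimep_expr // coprimep_XsubC2 // subr_eq0 eq_sym.
Qed.

Lemma dvdp_prod_XsubC_exp s N p : uniq s ->
    (forall a, a \in s -> ('X - a%:P) ^+ N %| p) ->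
  \prod_(a <- s) ('X - a%:P) ^+ N %| p.
Proof.
elim: s => [|a s IHs] /=; first by rewrite big_nil dvd1p.
case/andP=> nsa uniq_s dvd_p; rewrite big_cons.
rewrite Gauss_dvdp ?coprimep_XsubC_exp_prod // dvd_p ?mem_head //= IHs // => b sb.
by rewrite dvd_p // inE sb orbT.
Qed.

Lemma polynomial_CRT s N (f : K -> K) : uniq s ->
  exists q, forall a, a \in s -> ('X - a%:P) ^+ N %| q - (f a)%:P.
Proof.
elim: s => [|a s IHs] /=; first by exists 0.
case/andP=> nsa /IHs[q qs].
have /Bezout_eq1_coprimepP[[u v] /= uv1] := coprimep_XsubC_exp_prod N nsa.
set P := _ ^+ N in uv1; set Q := \prod_(b <- s) _ in uv1.
have defP : u * P = 1 - v * Q by rewrite -uv1 addrK.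
(* By Bezout, [u * P] is 0 modulo [P] and 1 modulo [Q], while [v * Q] is 1 modulo [P] and 0 modulo
   [Q]. *)
exists (q * (u * P) + (f a)%:P * (v * Q)) => b; rewrite inE => /predU1P[->|sb].
  suffices -> : q * (u * P) + (f a)%:P * (v * Q) - (f a)%:P = (q - (f a)%:P) * u * P.
    exact: dvdp_mull.
  by rewrite -[in RHS]mulrA defP; ring.
suffices -> : q * (u * P) + (f a)%:P * (v * Q) - (f b)%:P
    = (q - (f b)%:P) + ((f a)%:P - q) * v * Q.
  rewrite dvdp_addr ?qs // dvdp_mull // /Q (big_rem b) //= dvdp_mulr //.
by rewrite defP; ring.
Qed.

End PolynomialCRT.

Section MatrixTrace.
Variables (F : fieldType) (n : nat).
Implicit Types A e : 'M[F]_n.+1.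

(** Over polynomials [X - A] divides [X^k - A^k = X^k]. Taking determinants, [char_poly A] divides a
    power of [X], so it is one itself, and its trace coefficient vanishes. *)
Lemma mxtrace_nilpotent A k : A ^+ k = 0 -> \tr A = 0.
Proof.
move=> Ak0; pose AX : 'M[{poly F}]_n.+1 := map_mx polyC A.
have comXA : GRing.comm 'X%:M AX by exact: esym (scalar_mxC _ _).
have: char_poly A %| ('X - 0%:P) ^+ (k * n.+1).
  rewrite subr0 exprM -det_scalar.
  have -> : ('X^k)%:M = 'X%:M ^+ k - AX ^+ k :> 'M[{poly F}]_n.+1.
    by rewrite -!rmorphXn /= Ak0 rmorph0 subr0.
  by rewrite subrXX_comm // det_mulmx dvdp_mulr.
case/dvdp_exp_XsubCP=> j _; rewrite subr0 eqp_monic ?char_poly_monic ?monicXn //.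
move=> /eqP chA; apply: oppr_inj; rewrite -char_poly_trace // chA coefXn oppr0.
have := size_char_poly A; rewrite chA size_polyXn => -[->].
by rewrite -[_.-1]/n (_ : (n == n.+1) = false) //; elim: (n).
Qed.

(** A full rank factorization [A = C R] of an idempotent has [R C = 1], and
    [tr (C R) = tr (R C)]. *)
Lemma mxtrace_idempotent A : A * A = A -> \tr A = (\rank A)%:R.
Proof.
move=> AA; have := mulmx_base A; have := row_base_free A; have := col_base_full A.
move: (row_base A) (col_base A) => R C fullC freeR defA.
rewrite -{1}defA mxtrace_mulC -mxtrace1; congr (\tr _).
apply: (row_full_inj fullC); apply: (row_free_inj freeR).
by rewrite mulmx1 defA !mulmxA defA -mulmxA defA; exact: AA.
Qed.

End MatrixTrace.

(** * Spectral resolutions and replicas *)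

(** In each binomial term one of the two exponents is at least [N]. The factor [w] plays the role of
    a restriction to a subspace. *)
Lemma nilpotent_exprB (R : nzRingType) (u v w : R) N :
  GRing.comm u v -> w * u ^+ N = 0 -> w * v ^+ N = 0 -> w * (u - v) ^+ (N + N) = 0.
Proof.
move=> uv uN vN; have wP (a b : R) : w * a ^+ N = 0 -> GRing.comm a b ->
    forall k l, (N <= k)%N -> w * (b ^+ l * a ^+ k) = 0.
  move=> aN ab k l le_Nk; rewrite (commrX k (commr_sym (commrX l ab))).
  by rewrite -(subnKC le_Nk) exprD !mulrA aN !mul0r.
rewrite exprBn_comm // mulr_sumr big1 // => i _.
rewrite -mulrA mulrnAr [w * _]mulrA (commr_sign w i) -mulrA.
have [le_Ni|lt_iN] := leqP N i.
  by rewrite (wP v u) // ?mulr0 ?mul0rn //; exact: commr_sym.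
rewrite (commrX _ (commr_sym (commrX _ (commr_sym uv)))) (wP u v) ?mulr0 ?mul0rn //.
by rewrite leq_subRL ?leq_add2r ltnW // (leq_trans lt_iN) ?leq_addr.
Qed.

Section Ad.
Variables (K : fieldType) (A : falgType K).
Implicit Types (x y z e f : A).

Definition ad x : 'End(A) := amull x - amulr x.

Lemma adE x z : ad x z = commutator x z.
Proof. by rewrite /ad !lfunE /= !lfunE /= lfunE. Qed.

Lemma horner_ad_stable x (S : {vspace A}) q :
    (forall z, z \in S -> commutator x z \in S) ->
  forall z, z \in S -> horner_alg (ad x) q z \in S.
Proof.
move=> xS z Sz; rewrite /horner_alg /horner_morph.
elim/poly_ind: q z Sz => [|q c IHq] z Sz; first by rewrite rmorph0 horner0 lfunE mem0v.
rewrite rmorphD rmorphM /= map_polyX map_polyC /= hornerMXaddC.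
rewrite lfunE /= lfun_mulE memvD //; first by rewrite adE xS ?IHq.
by rewrite lfunE /= lfunE memvZ.
Qed.

(** On elements [e z f], [ad x - (a - b)] is the difference of the commuting maps [L_x - a] and
    [R_x - b], both nilpotent there. So its power [N + N] vanishes and [q] acts as the constant
    [c]. *)
Lemma horner_ad_eigen x e f (a b c : K) N q :
    (x - a%:A) ^+ N * e = 0 -> f * (x - b%:A) ^+ N = 0 ->
    ('X - (a - b)%:P) ^+ (N + N) %| q - c%:P ->
  forall z, horner_alg (ad x) q (e * z * f) = c *: (e * z * f).
Proof.
move=> xe xf /dvdpP[u def_q] z.
(* Products in ['End(A)] apply the left factor first, so [w] acts before the polynomial. *)
pose w : 'End(A) := amull e * amulr f.
have wE y : w y = e * y * f by rewrite lfun_mulE !lfunE.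
suffices: w * horner_alg (ad x) (q - c%:P) = 0.
  move/lfunP/(_ z); rewrite lfun_mulE wE rmorphB /= horner_algC.
  rewrite add_lfunE opp_lfunE scale_lfunE id_lfunE zero_lfunE => /eqP.
  by rewrite subr_eq0 => /eqP.
have -> : horner_alg (ad x) (q - c%:P) =
    (amull (x - a%:A) - amulr (x - b%:A)) ^+ (N + N) * horner_alg (ad x) u.
  rewrite def_q mulrC rmorphM rmorphXn rmorphB /= horner_algX horner_algC.
  congr (_ ^+ _ * _); apply/lfunP => y.
  rewrite !add_lfunE !opp_lfunE scale_lfunE id_lfunE !lfunE /=.
  rewrite mulrBl mulrBr mulr_algl mulr_algr scalerBl !opprB.
  by rewrite addrACA [in RHS]addrACA [- (y * x) + _]addrC.
have amullX v N' : amull v ^+ N' = amull (v ^+ N').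
  by elim: N' => [|k IHk]; rewrite ?amull1 // exprS IHk exprSr amullM.
rewrite mulrA nilpotent_exprB ?mul0r //.
- by apply/lfunP => y; rewrite !lfun_mulE !lfunE /= mulrA.
- by apply/lfunP => y; rewrite amullX !lfun_mulE !lfunE /= !mulrA xe !mul0r.
- by apply/lfunP => y; rewrite -rmorphXn !lfun_mulE !lfunE /= -!mulrA xf !mulr0.
Qed.

End Ad.

Section Replica.
Variables (K : fieldType) (n : nat).
Implicit Types (x z : 'M[K]_n.+1).

(** Data of a Jordan-Chevalley decomposition, with semisimple part [\sum_i a i *: e i]. The [a i]
    may repeat and the [e i] may vanish. *)
Definition spectral_resolution x m (e : 'I_m -> 'M[K]_n.+1) (a : 'I_m -> K) N :=
  [/\ forall i j, e i * e j = if i == j then e i else 0,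
      \sum_i e i = 1,
      forall i, GRing.comm x (e i)
    & forall i, (x - (a i)%:A) ^+ N * e i = 0].

(** The idempotents are values at [x] of Chinese remainder polynomials with residues 0 and 1 at the
    eigenvalues. Their identities hold modulo every [(X - b)^N], hence at [x] by Cayley-Hamilton, as
    [N] bounds all multiplicities. *)
Lemma spectral_resolution_exists x s : char_poly x = \prod_(a <- s) ('X - a%:P) ->
  exists m (e : 'I_m -> 'M[K]_n.+1) a N, spectral_resolution x e a N.
Proof.
move=> ch_x; pose t := undup s; pose N := size s.
have dvd_ch : char_poly x %| \prod_(a <- t) ('X - a%:P) ^+ N.
  rewrite ch_x prodrXl /N.
  have: {subset s <= t} by move=> a; rewrite mem_undup.
  elim: (s) => [|a u IHu] sut; first by rewrite big_nil dvd1p.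
  rewrite big_cons exprS dvdp_mul //; last first.
    by apply: IHu => b ub; rewrite sut // inE ub orbT.
  by rewrite dvdp_XsubCl root_prod_XsubC sut ?mem_head.
have kill p : (forall a, a \in t -> ('X - a%:P) ^+ N %| p) -> horner_mx x p = 0.
  move/(dvdp_prod_XsubC_exp (undup_uniq s))/(dvdp_trans dvd_ch)/dvdpP=> [u ->].
  by rewrite rmorphM /= Cayley_Hamilton mulr0.
pose f (i : 'I_(size t)) (b : K) : K := (b == t`_i)%:R.
have /choice[q qP] : forall i : 'I_(size t),
    exists q : {poly K}, forall b, b \in t -> ('X - b%:P) ^+ N %| q - (f i b)%:P.
  by move=> i; apply: polynomial_CRT; apply: undup_uniq.
have q0 (i : 'I_(size t)) b : b \in t -> b != t`_i -> ('X - b%:P) ^+ N %| q i.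
  by move=> tb /negPf nbi; have := qP i b tb; rewrite /f nbi subr0.
have q1 (i : 'I_(size t)) : ('X - (t`_i)%:P) ^+ N %| q i - 1.
  by have := qP i t`_i (mem_nth 0 (ltn_ord i)); rewrite /f eqxx.
exists (size t), (fun i => horner_mx x (q i)), (fun i => t`_i), N; split=> [i j||i|i].
- have [<-|neq_ij] := eqVneq i j.
    apply/eqP; rewrite -subr_eq0; apply/eqP; rewrite -rmorphM -rmorphB; apply: kill => b tb.
    have -> : q i * q i - q i = q i * (q i - 1) by rewrite mulrBr mulr1.
    have [->|nbi] := eqVneq b t`_i.
      by rewrite dvdp_mull.
    by rewrite dvdp_mulr ?q0.
  rewrite -rmorphM; apply: kill => b tb; have [bi|nbi] := eqVneq b t`_i.
    by rewrite dvdp_mull ?q0 // bi nth_uniq ?undup_uniq.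
  by rewrite dvdp_mulr ?q0.
- apply/eqP; rewrite -subr_eq0 -rmorph_sum -(rmorph1 (horner_mx x)) -rmorphB.
  apply/eqP; apply: kill => b tb; have [k lt_k def_b] := nthP 0 tb.
  rewrite (bigD1 (Ordinal lt_k)) //= addrAC dvdp_addr; last by rewrite -def_b (q1 (Ordinal lt_k)).
  apply: (big_ind (fun p => ('X - b%:P) ^+ N %| p)) => [||i /= neq_ik]; first by rewrite dvdp0.
    by move=> u v; apply: dvdp_add.
  by rewrite q0 // -def_b nth_uniq ?undup_uniq // eq_sym.
- by have := comm_horner_mx2 x 'X (q i); rewrite horner_mx_X.
- have -> : x - (t`_i)%:A = horner_mx x ('X - (t`_i)%:P).
    by rewrite rmorphB /= horner_mx_X horner_mx_C -scalemx1.
  rewrite -rmorphXn -rmorphM; apply: kill => b tb.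
  have [->|nbi] := eqVneq b t`_i; first by rewrite dvdp_mulr.
  by rewrite dvdp_mull ?q0.
Qed.

Section Resolution.
Variables (x : 'M[K]_n.+1) (m : nat) (e : 'I_m -> 'M[K]_n.+1) (a : 'I_m -> K) (N : nat).
Hypothesis x_res : spectral_resolution x e a N.

(* Any q with q = r_i - r_j mod (X - (a_i - a_j))^(2N) satisfies
   q(ad x) = ad (\sum_i r_i e_i). *)
Lemma ad_replica (r : 'I_m -> K) (S : {vspace 'M[K]_n.+1}) :
    (forall i j k l, a i - a j = a k - a l -> r i - r j = r k - r l) ->
    (forall z, z \in S -> commutator x z \in S) ->
  forall z, z \in S -> commutator (\sum_i r i *: e i) z \in S.
Proof.
have [ee e1 xe xNe] := x_res.
move=> r_lin xS z Sz; pose d (ij : 'I_m * 'I_m) := a ij.1 - a ij.2.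
(* A difference may come from several pairs; by [r_lin] the choice does not affect the value. The
   default 0 is for scalars that are no difference. *)
pose f b := if [pick ij | d ij == b] is Some ij then r ij.1 - r ij.2 else 0.
have fE i j : f (a i - a j) = r i - r j.
  rewrite /f; case: pickP => [[k l] /eqP|/(_ (i, j))]; last by rewrite eqxx.
  exact: r_lin.
have [q qP] := polynomial_CRT (N + N) f (undup_uniq (codom d)).
have eze i j : horner_alg (ad x) q (e i * z * e j) =
    (r i - r j) *: (e i * z * e j).
  rewrite -fE; apply: (horner_ad_eigen (xNe i) _ (qP _ _)).
    have xaej : GRing.comm (e j) (x - (a j)%:A).
      by apply: commrB; [exact/commr_sym/xe | rewrite /GRing.comm mulr_algl mulr_algr].
    by rewrite (commrX N xaej) xNe.
  by rewrite mem_undup (codom_f d (i, j)).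
suffices -> : commutator (\sum_i r i *: e i) z = horner_alg (ad x) q z.
  exact: horner_ad_stable.
have zE : z = \sum_i \sum_j e i * z * e j.
  under eq_bigr do rewrite -mulr_sumr e1 mulr1.
  by rewrite -mulr_suml e1 mul1r.
rewrite [in RHS]zE raddf_sum /=; under [RHS]eq_bigr do rewrite raddf_sum /=.
under [RHS]eq_bigr do under eq_bigr do rewrite eze scalerBl.
under [RHS]eq_bigr do rewrite sumrB.
rewrite sumrB [X in _ - X]exchange_big /commutator; congr (_ - _).
  rewrite mulr_suml; apply: eq_bigr => i _.
  by rewrite -scaler_sumr -mulr_sumr e1 mulr1 scalerAl.
rewrite mulr_sumr; apply: eq_bigr => j _.
by rewrite -scaler_sumr -mulr_suml -mulr_suml e1 mul1r scalerAr.
Qed.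

(** Each [(x - a i) e i] is nilpotent, hence of trace 0, and the trace of [e i] is its rank. *)
Lemma mxtrace_resolution (r : 'I_m -> K) :
  \tr (x * \sum_i r i *: e i) = \sum_i r i * a i * (\rank (e i))%:R.
Proof.
have [ee e1 xe xNe] := x_res.
rewrite mulr_sumr raddf_sum /=; apply: eq_bigr => i _.
have eei : e i * e i = e i by rewrite ee eqxx.
rewrite -scalerAr mxtraceZ -mulrA; congr (_ * _).
rewrite -mxtrace_idempotent // -mxtraceZ -mulr_algl; apply/eqP.
rewrite -subr_eq0 -raddfB /= -mulrBl; apply/eqP.
apply: (mxtrace_nilpotent (k := N.+1)); rewrite exprMn_comm.
  by rewrite exprS [e i ^+ _]exprS -mulrA [X in _ * X]mulrA xNe mul0r mulr0.
apply/commr_sym/commrB; first exact/commr_sym/xe.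
by rewrite /GRing.comm mulr_algl mulr_algr.
Qed.

Lemma nilpotent_resolution : (forall i, e i != 0 -> a i = 0) -> x ^+ N = 0.
Proof.
have [ee e1 xe xNe] := x_res.
move=> a0; rewrite -[LHS]mulr1 -e1 mulr_sumr big1 // => i _.
have [->|/a0 ai0] := eqVneq (e i) 0; first by rewrite mulr0.
by have := xNe i; rewrite ai0 scale0r subr0.
Qed.

End Resolution.

End Replica.

(** * Nilpotency over a splitting field *)

(* [ratr] is only a canonical morphism into number fields. *)
Lemma pchar0_rat_rmorphism (K : fieldType) : [pchar K] =i pred0 ->
  exists g : {rmorphism rat -> K}, True.
Proof.
move=> /pcharf0P natr_eq0; have nz_int (z : int) : z != 0 -> z%:~R != 0 :> K.
  by case: z => k nz; rewrite ?NegzE ?rmorphN ?oppr_eq0 /= -pmulrn natr_eq0.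
have nz_den (x : rat) : (denq x)%:~R != 0 :> K by rewrite nz_int ?denq_eq0.
have ratrE (x : rat) (p q : int) : x * q%:~R = p%:~R -> ratr x * q%:~R = p%:~R :> K.
  move=> xq; have /intr_inj eq_pq : (numq x * q)%:~R = (denq x * p)%:~R :> rat.
    by rewrite !rmorphM /= -xq numqE; ring.
  by rewrite /ratr mulrAC -rmorphM eq_pq rmorphM mulrAC divff ?mul1r ?nz_den.
have den (x : rat) : ratr x * (denq x)%:~R = (numq x)%:~R :> K by rewrite divfK.
have ratr_zmod : zmod_morphism (@ratr K).
  move=> x y; apply: (mulIf (nz_den x)); apply: (mulIf (nz_den y)).
  rewrite -mulrA -rmorphM /= (ratrE _ (numq x * denq y - numq y * denq x)).
    by rewrite rmorphB !rmorphM /= -!den; ring.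
  by rewrite rmorphB !rmorphM /= !numqE; ring.
have ratr_monoid : monoid_morphism (@ratr K).
  split=> [|x y]; first by rewrite -[LHS]mulr1 (ratrE 1 1 1) ?mulr1.
  apply: (mulIf (nz_den x)); apply: (mulIf (nz_den y)).
  rewrite -mulrA -rmorphM /= (ratrE _ (numq x * numq y)).
    by rewrite rmorphM /= -!den; ring.
  by rewrite !rmorphM /= !numqE; ring.
pose gA := GRing.isZmodMorphism.Build _ _ (@ratr K) ratr_zmod.
pose gM := GRing.isMonoidMorphism.Build _ _ (@ratr K) ratr_monoid.
by pose g : {rmorphism rat -> K} := HB.pack (@ratr K) gA gM; exists g.
Qed.

(* A maximal-rank matrix of relations has trivial kernel, so every vector is a relation. *)
Lemma rational_relations (K : fieldType) (g : {rmorphism rat -> K}) m (a : 'I_m -> K) :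
    (forall r : 'I_m -> rat,
       (forall c : 'I_m -> rat, \sum_i g (c i) * a i = 0 -> \sum_i c i * r i = 0) ->
     forall i, r i = 0) ->
  forall i, a i = 0.
Proof.
move=> orth0; pose rel (v : 'rV[rat]_m) := \sum_i g (v 0 i) * a i = 0.
have relD u v : rel u -> rel v -> rel (u + v).
  move=> ru rv; rewrite /rel; under eq_bigr do rewrite mxE rmorphD mulrDl.
  by rewrite big_split /= ru rv addr0.
have relZ c u : rel u -> rel (c *: u).
  move=> ru; rewrite /rel; under eq_bigr do rewrite mxE rmorphM -mulrA.
  by rewrite -mulr_sumr ru mulr0.
pose P k := `[< exists A : 'M[rat]_m, \rank A = k /\ forall v, (v <= A)%MS -> rel v >].
have exP : exists k, P k.
  exists 0%N; apply/asboolP; exists 0; split=> [|v]; first exact: mxrank0.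
  by rewrite submx0 => /eqP ->; rewrite /rel big1 // => i _; rewrite mxE rmorph0 mul0r.
have leP k : P k -> (k <= m)%N by case/asboolP=> A [<- _]; apply: rank_leq_row.
case: (ex_maxnP exP leP) => k /asboolP[A [rkA relA]] max_k.
have in_A v : rel v -> (v <= A)%MS.
  move=> rv; have sAAv := addsmxSl A v; suffices sAvA : (A + v <= A)%MS.
    exact: submx_trans (addsmxSr _ _) sAvA.
  rewrite -(geq_leqif (mxrank_leqif_sup sAAv)) rkA max_k //; apply/asboolP.
  exists (A + v)%MS; split=> // _ /sub_addsmxP[[u w] /= ->].
  apply: relD; first by apply: relA; apply: submxMl.
  by rewrite [w]mx11_scalar mul_scalar_mx; apply: relZ.
(* A row orthogonal to all rows of [A] is orthogonal to every relation by [in_A], hence zero by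
   [orth0]. *)
have freeAT : row_free A^T.
  rewrite -kermx_eq0; apply/eqP/row_matrixP => j; rewrite row0.
  have: row j (kermx A^T) *m A^T = 0 by rewrite -row_mul mulmx_ker row0.
  move: (row j _) => u uA0; apply/rowP => i; rewrite mxE; apply: (orth0 (u 0)) i => c rel_c.
  have /submxP[w def_c] : (\row_i c i <= A)%MS.
    by apply: in_A; rewrite /rel; under eq_bigr do rewrite mxE.
  have: (\row_i c i *m u^T) 0 0 = 0.
    by rewrite def_c -mulmxA -[A]trmxK -trmx_mul uA0 trmx0 mulmx0 mxE.
  by rewrite mxE => cu0; rewrite -[RHS]cu0; apply: eq_bigr => i _; rewrite !mxE.
move=> i; have fullA : row_full A by rewrite /row_full -mxrank_tr.
have := relA (delta_mx 0 i) (submx_full _ fullA).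
rewrite /rel (bigD1 i) //= big1 => [|j neq_ji]; rewrite mxE eqxx.
  by rewrite eqxx rmorph1 mul1r addr0.
by rewrite (negPf neq_ji) rmorph0 mul0r.
Qed.

(** * The trace form and Cartan's eigenvalue argument *)

Section TraceForm.
Variables (K : fieldType) (n : nat).
Implicit Types (x y z : 'M[K]_n.+1) (S : {vspace 'M[K]_n.+1}).

(** Valued in [K^o] so that it is a linear map in [z], with a subspace as kernel. *)
Definition trace_form y z : K^o := \tr (z * y).

Fact trace_form_is_linear y : linear (trace_form y).
Proof. by move=> a u v; rewrite /trace_form mulrDl -scalerAl mxtraceD mxtraceZ. Qed.
HB.instance Definition _ y := GRing.isLinear.Build K 'M[K]_n.+1 K^o _ (trace_form y)
  (trace_form_is_linear y).

Definition trace_orth y : {vspace 'M[K]_n.+1} := lker (linfun (trace_form y)).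

Lemma mem_trace_orth y z : (z \in trace_orth y) = (\tr (z * y) == 0).
Proof. by rewrite memv_ker lfunE. Qed.

Lemma mxtrace_mulrC x y : \tr (x * y) = \tr (y * x).
Proof. exact: mxtrace_mulC. Qed.

(** Invariance of the trace form, by cyclicity: [tr (y x z) = tr (x z y)]. *)
Lemma mxtrace_commutator x y z : \tr (commutator x y * z) = \tr (x * commutator y z).
Proof.
rewrite /commutator mulrBl mulrBr !raddfB /= -!mulrA; congr (_ - _).
by rewrite mxtrace_mulrC mulrA.
Qed.

(** All scalars [a i] of a spectral resolution of [x] vanish. By [rational_relations], take rational
    [r] satisfying every rational relation between the [a i]: then [y = \sum_i r i e_i] normalizes
    [S], so [tr (x y) = 0]. This is a relation with coefficients [r i * rank (e i)]; as [r]
    satisfies it too, a weighted sum of squares of the [r i] vanishes. *)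
Lemma perfect_trace0_nilpotent S x s : [pchar K] =i pred0 ->
    lprodv (@commutator _ _) S S = S ->
    (forall u v, u \in S -> v \in S -> \tr (u * v) = 0) ->
    x \in S -> char_poly x = \prod_(a <- s) ('X - a%:P) ->
  exists p, x ^+ p = 0.
Proof.
move=> charK0 perfS trS Sx /spectral_resolution_exists[m [e [b [N x_res]]]].
have [g _] := pchar0_rat_rmorphism charK0.
have lieS u v : u \in S -> v \in S -> commutator u v \in S.
  by move=> Su Sv; rewrite -perfS memv_lprodv.
(* Discarding the scalars attached to zero idempotents makes every rational
   functional vanish on them. *)
pose a i := if e i == 0 then 0 else b i.
have{x_res} x_res : spectral_resolution x e a N.
  case: x_res => ee e1 xe xNe; split=> // i; rewrite /a.
  by case: eqP => [->|_]; rewrite ?mulr0.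
exists N; apply: (nilpotent_resolution x_res) => i _; move: i.
apply: (rational_relations (g := g)) => r r_orth.
have sum_delta (v : 'I_m -> rat) i : \sum_j (j == i)%:R * v j = v i.
  rewrite (bigD1 i) //= eqxx mul1r big1 ?addr0 // => j /negPf->.
  by rewrite mul0r.
have sum_deltaK i : \sum_j g (j == i)%:R * a j = a i.
  rewrite (bigD1 i) //= eqxx rmorph1 mul1r big1 ?addr0 // => j /negPf->.
  by rewrite rmorph0 mul0r.
have r_lin i j k l : a i - a j = a k - a l -> g (r i) - g (r j) = g (r k) - g (r l).
  move=> eq_a; rewrite -!rmorphB; congr (g _); apply/eqP; rewrite -subr_eq0; apply/eqP.
  pose c t : rat := (t == i)%:R - (t == j)%:R - ((t == k)%:R - (t == l)%:R).
  have <- : \sum_t c t * r t = r i - r j - (r k - r l).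
    by under eq_bigr do rewrite !mulrBl; rewrite !sumrB !sum_delta.
  apply: r_orth; under eq_bigr do rewrite !rmorphB !mulrBl.
  by rewrite !sumrB !sum_deltaK eq_a subrr.
pose y := \sum_i g (r i) *: e i.
have yS z : z \in S -> commutator y z \in S.
  by apply: (ad_replica x_res r_lin) => u; apply: lieS.
(* [x] is a combination of commutators [[u, v]], and [tr ([u, v] y) = tr (u [v, y]) = 0]. *)
have xy0 : \tr (x * y) = 0.
  apply/eqP; rewrite -mem_trace_orth; apply: (subvP _ x Sx); rewrite -perfS.
  apply/lprodvP => u v Su Sv; rewrite mem_trace_orth mxtrace_commutator.
  rewrite -[commutator v y]opprB mulrN raddfN /= oppr_eq0 -/(commutator y v).
  by rewrite trS ?yS.
have r2 : \sum_i r i * (\rank (e i))%:R * r i = 0.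
  apply: r_orth; rewrite -[RHS]xy0 (mxtrace_resolution x_res). apply: eq_bigr => i _.
  by rewrite rmorphM rmorph_nat mulrAC.
move=> i; have [ei0|ei_neq0] := eqVneq (e i) 0.
  by rewrite -(sum_delta r i); apply: r_orth; rewrite sum_deltaK /a ei0 eqxx.
have r2_ge0 j : true -> 0 <= r j * (\rank (e j))%:R * r j.
  by rewrite mulrAC mulr_ge0 ?ler0n // -expr2 sqr_ge0.
have := psumr_eq0P r2_ge0 r2 (i := i) isT; move/eqP.
by rewrite !mulf_eq0 pnatr_eq0 mxrank_eq0 (negPf ei_neq0) orbF orbb => /eqP.
Qed.

End TraceForm.

(** * Cartan's criterion *)

Lemma irreducible_factor_exists (F : fieldType) (p : {poly F}) : (1 < size p)%N ->
  exists2 q, irreducible_poly q & q %| p.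
Proof.
have [k] := ubnP (size p); elim: k p => // k IHk p; rewrite ltnS => le_pk p_gt1.
have [irr_p|red_p] := pselect (irreducible_poly p); first by exists p.
apply: contrapT => no_q; apply: red_p; split=> // q q_neq1 dvd_qp.
apply: contrapT => /negP neq_qp; have nz_p : p != 0 by rewrite -size_poly_gt0 ltnW.
have q_gt1 : (1 < size q)%N.
  rewrite ltn_neqAle eq_sym q_neq1 size_poly_gt0.
  by apply: contraNneq nz_p => q0; move: dvd_qp; rewrite q0 dvd0p.
have lt_qp : (size q < size p)%N.
  by rewrite ltn_neqAle dvdp_leq // andbT dvdp_size_eqp.
have [u irr_u dvd_uq] := IHk q (leq_trans lt_qp le_pk) q_gt1.
by apply: no_q; exists u; last exact: dvdp_trans dvd_qp.
Qed.

(** Adjoin a root of an irreducible factor, split off one linear factor and continue over the larger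
    field; hence the induction ranges over all [F]. *)
Lemma splitting_extension (F : fieldType) (p : {poly F}) : p \is monic ->
  exists (K : fieldType) (f : {rmorphism F -> K}) (s : seq K),
    map_poly f p = \prod_(a <- s) ('X - a%:P).
Proof.
have [k] := ubnP (size p); elim: k F p => // k IHk F p; rewrite ltnS => le_pk mon_p.
have [p_le1|p_gt1] := leqP (size p) 1.
  exists F, idfun, [::]; rewrite map_poly_id // big_nil.
  have := monicP mon_p; rewrite (size1_polyC p_le1) lead_coefC => -> //.
have [q irr_q dvd_qp] := irreducible_factor_exists p_gt1.
have [L _ [z qz0 _]] := irredp_FAdjoin irr_q.
have pz0 : root (map_poly (in_alg L) p) z.
  by rewrite -dvdp_XsubCl; apply: dvdp_trans (_ : _ %| map_poly (in_alg L) q) _;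
    rewrite ?dvdp_XsubCl ?dvdp_map.
have /factor_theorem[r def_p] := pz0.
have mon_r : r \is monic.
  by rewrite -(monicMr _ (monicXsubC z)) -def_p map_monic.
have lt_r : (size r < k)%N.
  apply: leq_trans le_pk; rewrite -(size_map_poly (in_alg L)) def_p.
  by rewrite size_Mmonic ?monicXsubC ?monic_neq0 // size_XsubC addn2.
have [K [f [s def_r]]] := IHk L r lt_r mon_r.
exists K, (f \o in_alg L), (f z :: s).
by rewrite big_cons -def_r mulrC map_poly_comp def_p rmorphM /= map_polyXsubC.
Qed.

(** * Extension of scalars for spaces of matrices *)

Section BaseChange.
Variables (F K : fieldType) (f : {rmorphism F -> K}) (n : nat).
Local Notation "A ^f" := (map_mx f A) : ring_scope.
Implicit Types S : {vspace 'M[F]_n.+1}.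

Lemma map_mx_span (X : seq 'M[F]_n.+1) (W : {vspace 'M[K]_n.+1}) :
  (forall u, u \in X -> u^f \in W) -> forall u, u \in <<X>>%VS -> u^f \in W.
Proof.
move=> XW u /(@coord_span _ _ _ (in_tuple X)) ->.
rewrite map_mx_sum memv_suml // => i _; rewrite map_mxZ memvZ // XW //.
by rewrite mem_nth.
Qed.

Definition base_change (S : {vspace 'M[F]_n.+1}) : {vspace 'M[K]_n.+1} :=
  <<[seq u^f | u <- vbasis S]>>%VS.

Lemma memv_base_change S u : u \in S -> u^f \in base_change S.
Proof.
by rewrite -{1}(span_basis (vbasisP S)); apply: map_mx_span => v Sv; rewrite memv_span ?map_f.
Qed.

Lemma base_change_sub (S : {vspace 'M[F]_n.+1}) (W : {vspace 'M[K]_n.+1}) :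
  (forall u, u \in S -> u^f \in W) -> (base_change S <= W)%VS.
Proof.
by move=> SW; apply/span_subvP => _ /mapP[u Su ->]; apply: SW; apply: vbasis_mem.
Qed.

Lemma map_commutator (u v : 'M[F]_n.+1) : (commutator u v)^f = commutator u^f v^f.
Proof. by rewrite /commutator map_mxB !map_mxM. Qed.

(** Stability passes from [S] to its span over [K] in one argument at a time; antisymmetry exchanges
    the arguments. *)
Lemma base_change_perfect S : lprodv (@commutator _ _) S S = S ->
  lprodv (@commutator _ _) (base_change S) (base_change S) = base_change S.
Proof.
move=> perfS; apply/eqP; rewrite eqEsubv; apply/andP; split; last first.
  apply: base_change_sub => u; rewrite -{1}perfS; apply: map_mx_span.
  move=> _ /allpairsP[[v w] /= [/vbasis_mem Sv /vbasis_mem Sw ->]].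
  by rewrite map_commutator memv_lprodv ?memv_base_change.
have stable u : u \in S -> (base_change S <= ad u^f @^-1: base_change S)%VS.
  move=> Su; apply: base_change_sub => v Sv.
  by rewrite -memv_preim adE -map_commutator memv_base_change // -perfS memv_lprodv.
apply/lprodvP => u v Su Sv; rewrite -memvN opprB -/(commutator v u) -adE memv_preim.
apply: (subvP (base_change_sub _)) Su => w Sw.
rewrite -memv_preim adE -memvN opprB -/(commutator w^f v) -adE memv_preim.
exact: (subvP (stable w Sw)).
Qed.

Lemma base_change_trace0 S : (forall u v, u \in S -> v \in S -> \tr (u * v) = 0) ->
  forall u v, u \in base_change S -> v \in base_change S -> \tr (u * v) = 0.
Proof.
move=> trS u v Su Sv.
have S_orth w : w \in S -> (base_change S <= trace_orth w^f)%VS.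
  move=> Sw; apply: base_change_sub => z Sz; rewrite mem_trace_orth.
  by rewrite -[_ * _]map_mxM trace_map_mx trS ?rmorph0.
apply/eqP; rewrite mxtrace_mulrC -mem_trace_orth; apply: subvP v Sv.
apply: base_change_sub => w Sw; rewrite mem_trace_orth mxtrace_mulrC -mem_trace_orth.
exact: (subvP (S_orth w Sw)).
Qed.

End BaseChange.

(** Nilpotency of [x] is checked over a field splitting its characteristic polynomial: extending
    scalars keeps the hypotheses, and [map_mx f] is injective. Engel's theorem is then applied over
    [F]. *)
Theorem cartan_perfect (F : fieldType) n (S : {vspace 'M[F]_n.+1}) : [pchar F] =i pred0 ->
    lprodv (@commutator _ _) S S = S ->
    (forall u v, u \in S -> v \in S -> \tr (u * v) = 0) ->
  S = 0%VS.
Proof.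
move=> charF0 perfS trS; apply: (perfect_nil_eq0 perfS) => x Sx.
have [K [f [s ch_x]]] := splitting_extension (char_poly_monic x).
have [|||||p xp0] := @perfect_trace0_nilpotent K n (base_change f S) (map_mx f x) s.
- by move=> p; rewrite (fmorph_pchar f).
- exact: base_change_perfect.
- exact: base_change_trace0.
- exact: memv_base_change.
- by rewrite -map_char_poly.
exists p; apply/eqP; rewrite -(map_mx_eq0 f); apply/eqP; rewrite -xp0.
by rewrite rmorphXn.
Qed.

(** * Casimir elements *)

Section Casimir.
Variables (F : fieldType) (n : nat).
Implicit Types (x y z : 'M[F]_n.+1) (G : {vspace 'M[F]_n.+1}).

(** [X] is a basis of [G], and [Y] comes from the inverse of its Gram matrix, invertible by
    nondegeneracy. *)
Lemma trace_dual_bases G :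
    (forall x, x \in G -> (forall y, y \in G -> \tr (x * y) = 0) -> x = 0) ->
  exists X Y : 'I_(\dim G) -> 'M[F]_n.+1,
    [/\ forall i, X i \in G, forall i, Y i \in G,
        forall i j, \tr (X i * Y j) = (i == j)%:R,
        forall z, z \in G -> z = \sum_i \tr (z * Y i) *: X i
      & forall z, z \in G -> z = \sum_i \tr (z * X i) *: Y i].
Proof.
move=> nondeg; pose X i := (vbasis G)`_i.
have GX (i : 'I_(\dim G)) : X i \in G by rewrite vbasis_mem ?mem_nth ?size_tuple.
have ortho0 x : x \in G -> (forall i : 'I_(\dim G), \tr (x * X i) = 0) -> x = 0.
  move=> Gx xX0; apply: nondeg => // y /coord_vbasis->.
  rewrite mulr_sumr raddf_sum big1 // => i _ /=.
  by rewrite -scalerAr mxtraceZ xX0 mulr0.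
pose M := \matrix_(i < \dim G, j < \dim G) \tr (X i * X j).
have unitM : M \in unitmx.
  rewrite -row_free_unit -kermx_eq0; apply/eqP/row_matrixP => k; rewrite row0.
  have: row k (kermx M) *m M = 0 by rewrite -row_mul mulmx_ker row0.
  move: (row k _) => u uM0.
  have/freeP uX0 := basis_free (vbasisP G).
  apply/rowP => i; rewrite mxE; apply: (uX0 (u 0)) i.
  apply: ortho0 => [|j]; first by rewrite memv_suml // => i _; rewrite memvZ ?GX.
  have /rowP/(_ j) := uM0; rewrite !mxE => uMj; rewrite -[RHS]uMj mulr_suml raddf_sum.
  by apply: eq_bigr => i _ /=; rewrite mxE -scalerAl mxtraceZ.
pose Y j := \sum_i invmx M j i *: X i.
have GY j : Y j \in G by rewrite memv_suml // => i _; rewrite memvZ.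
have XY (i j : 'I_(\dim G)) : \tr (X i * Y j) = (i == j)%:R.
  have := congr1 (fun A : 'M_(\dim G) => A j i) (mulVmx unitM).
  rewrite !mxE eq_sym => <-; rewrite mulr_sumr raddf_sum.
  by apply: eq_bigr => k _ /=; rewrite mxE -scalerAr mxtraceZ mxtrace_mulrC.
exists X, Y; split=> // z Gz.
  rewrite {1}(coord_vbasis Gz); apply: eq_bigr => i _; congr (_ *: _).
  rewrite {2}(coord_vbasis Gz) mulr_suml raddf_sum (bigD1 i) //= big1 => [|j neq_ji].
    by rewrite -scalerAl mxtraceZ XY eqxx mulr1 addr0.
  by rewrite -scalerAl mxtraceZ XY (negPf neq_ji) mulr0.
apply/eqP; rewrite -subr_eq0; apply/eqP; apply: ortho0 => [|j].
  by rewrite memvB // memv_suml // => i _; rewrite memvZ.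
rewrite mulrBl raddfB /= mulr_suml; apply/eqP; rewrite subr_eq0 eq_sym; apply/eqP.
rewrite raddf_sum (bigD1 j) //= big1 => [|i neq_ij].
  by rewrite -scalerAl mxtraceZ [X in _ * X]mxtrace_mulrC XY eqxx mulr1 addr0.
by rewrite -scalerAl mxtraceZ [X in _ * X]mxtrace_mulrC XY eq_sym (negPf neq_ij) mulr0.
Qed.

(** Expand [[a, X i]] and [[a, Y i]] in the dual bases: invariance gives opposite coefficients, so
    the sum cancels. Here [a] ranges over the normalizer of [G], since the result is applied to
    elements outside [G]. *)
Lemma casimir G :
    (forall x, x \in G -> (forall y, y \in G -> \tr (x * y) = 0) -> x = 0) ->
  exists X Y : 'I_(\dim G) -> 'M[F]_n.+1,
    [/\ forall i, X i \in G, forall i, Y i \in G,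
        \tr (\sum_i X i * Y i) = (\dim G)%:R
      & forall a, (forall z, z \in G -> commutator a z \in G) ->
        GRing.comm a (\sum_i X i * Y i)].
Proof.
case/trace_dual_bases=> X [Y [GX GY XY expX expY]]; exists X, Y; split=> //.
  rewrite raddf_sum /= -[RHS]mulr1 mulr_natl -[in RHS](card_ord (\dim G)) -sumr_const.
  by apply: eq_bigr => i _; rewrite XY eqxx.
move=> a aG; apply/eqP; rewrite -subr_eq0 mulr_sumr mulr_suml -sumrB.
have comE i : a * (X i * Y i) - X i * Y i * a =
    (\sum_j \tr (commutator a (X i) * Y j) *: (X j * Y i))
    + \sum_j \tr (commutator a (Y i) * X j) *: (X i * Y j).
  transitivity (commutator a (X i) * Y i + X i * commutator a (Y i)).
    by rewrite /commutator mulrBl mulrBr !mulrA addrA subrK.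
  rewrite {1}(expX _ (aG _ (GX i))) {1}(expY _ (aG _ (GY i))) mulr_suml mulr_sumr.
  by congr (_ + _); apply: eq_bigr => j _; rewrite -?scalerAl -?scalerAr.
under eq_bigr do rewrite comE; rewrite big_split /= [X in X + _]exchange_big -big_split.
rewrite big1 // => i _; rewrite -big_split big1 // => j _ /=.
rewrite -scalerDl (_ : _ + _ = 0) ?scale0r //.
rewrite [X in _ + X]mxtrace_mulrC -[commutator a (Y i)]opprB -/(commutator (Y i) a).
rewrite mulrN raddfN /= -mxtrace_commutator [\tr (commutator (X j) _ * _)]mxtrace_mulrC.
by rewrite mxtrace_commutator subrr.
Qed.

(** [p(O)] projects onto the generalized kernel of [O]. Being a polynomial in [O], it commutes with
    all that commutes with [O]; and [p(0) = 1] makes it fix the vectors killed by [O]. *)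
Lemma fitting_idempotent (O : 'M[F]_n.+1) : exists (p : {poly F}) k,
  [/\ horner_mx O p * horner_mx O p = horner_mx O p, O ^+ k * horner_mx O p = 0
    & p.[0] = 1].
Proof.
have nz_ch := monic_neq0 (char_poly_monic O).
have [k [q]] := multiplicity_XsubC (char_poly O) 0; rewrite nz_ch subr0 /= => q0 ch_O.
(* The exponent [k.+1] instead of [k] ensures [p.[0] = 1] also when [k = 0]. *)
have /Bezout_eq1_coprimepP[[u v] /= uv1] : coprimep ('X ^+ k.+1) q.
  by rewrite coprimep_expl // coprimep_sym -['X]subr0 coprimep_XsubC.
have kill r : horner_mx O (r * q * 'X^k) = 0.
  by rewrite -mulrA -ch_O rmorphM /= Cayley_Hamilton mulr0.
exists (v * q), k; split.
- apply/eqP; rewrite -subr_eq0 -rmorphM -rmorphB /=.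
  have -> : v * q * (v * q) - v * q = - (v * u * 'X) * q * 'X^k.
    have defu : u * 'X^(k.+1) = 1 - v * q by rewrite -uv1 addrK.
    have -> : - (v * u * 'X) * q * 'X^k = - (v * q) * (u * 'X^(k.+1)) by rewrite exprS; ring.
    by rewrite defu; ring.
  by rewrite kill.
- by rewrite -{1}[O]horner_mx_X -rmorphXn -rmorphM /= mulrC kill.
have := congr1 (fun r : {poly F} => r.[0]) uv1.
by rewrite !hornerE exprS mul0r mulr0 add0r.
Qed.

(* A Casimir element kills [c], so [c] survives in the image of its Fitting idempotent,
   whose rank is strictly smaller because a Casimir element has nonzero trace. *)
Theorem invariant_in_span_eq0 G (c : 'rV[F]_n.+1) : [pchar F] =i pred0 ->
    (forall x y, x \in G -> y \in G -> commutator x y \in G) ->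
    (forall e, e * e = e -> (forall z, z \in G -> GRing.comm e z) ->
     forall x, x \in (amull e @: G)%VS ->
     (forall y, y \in (amull e @: G)%VS -> \tr (x * y) = 0) -> x = 0) ->
    (forall z, z \in G -> c *m z = 0) ->
    (forall e, (forall z, z \in G -> z * e = 0) -> c *m e = 0) ->
  c = 0.
Proof.
move=> /pcharf0P natr_eq0 lieG nondeg cG c_span.
suffices main k e : (\rank e <= k)%N -> e * e = e ->
    (forall z, z \in G -> GRing.comm e z) -> c *m e = c -> c = 0.
  apply: (main n.+1 1); rewrite ?rank_leq_row ?mulr1 ?mulmx1 // => z _.
  exact/commr_sym/commr1.
elim: k e => [|k IHk] e le_ek ee eG ce.
  by move: ce; have /eqP-> : e == 0; rewrite -?mxrank_eq0 -?leqn0 ?mulmx0.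
set H := (amull e @: G)%VS.
have HP z : z \in H -> exists2 y, y \in G & z = e * y.
  by case/memv_imgP=> y Gy ->; exists y; rewrite ?lfunE.
have memH y : y \in G -> e * y \in H.
  by move=> Gy; apply/memv_imgP; exists y; rewrite ?lfunE.
(* [c_span] says dually that [c] lies in the span of the rows of matrices of [G]; if [e G = 0], it
   gives [c e = 0]. *)
have [H0|nzH] := eqVneq (\dim H) 0%N.
  rewrite -ce; apply: c_span => z Gz; rewrite -(eG z Gz); apply/eqP.
  by rewrite -memv0 -(eqP (_ : H == 0%VS)) ?memH // -dimv_eq0 H0.
have [X [Y [HX HY trO comO]]] := casimir (nondeg e ee eG).
set O := \sum_i _ in trO comO.
have eO : GRing.comm e O.
  apply: comO => _ /HP[y Gy ->].
  suffices -> : commutator e (e * y) = 0 by apply: mem0v.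
  by rewrite /commutator -[e * y * e]mulrA -(eG y Gy) subrr.
have GO z : z \in G -> GRing.comm O z.
  move=> Gz; apply/commr_sym/comO => _ /HP[y Gy ->].
  have -> : commutator z (e * y) = e * commutator z y.
    by rewrite /commutator mulrBr !mulrA (eG z Gz).
  by rewrite memH ?lieG.
have Oe : O * e = O.
  rewrite mulr_suml; apply: eq_bigr => i _; have [y Gy ->] := HP _ (HY i).
  by rewrite -!mulrA -(eG y Gy) !mulrA -(mulrA _ e e) ee.
have cO : c *m O = 0.
  rewrite mulmx_sumr big1 // => i _; have [y Gy ->] := HP _ (HX i).
  by rewrite !mulmxA ce cG // mul0mx.
have [p [j [pp Op p0]]] := fitting_idempotent O.
set P := horner_mx O p in pp Op.
have comP z : GRing.comm z O -> GRing.comm z P.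
  by move=> zO; apply: comm_mx_horner.
have eP := comP e eO.
have cP : c *m P = c.
  suffices cq q : c *m horner_mx O q = q.[0] *: c by rewrite cq p0 scale1r.
  elim/poly_ind: q => [|q a IHq]; first by rewrite rmorph0 mulmx0 horner0 scale0r.
  rewrite rmorphD rmorphM /= horner_mx_X horner_mx_C mulmxDr mulmxA IHq -scalemxAl cO.
  by rewrite scaler0 add0r mul_mx_scalar !hornerE.
have ePeP : e * P * (e * P) = e * P.
  by rewrite mulrA -(mulrA e P e) -eP mulrA ee -mulrA pp.
have := IHk (e * P); apply=> //.
(* Were the rank unchanged, then [e = e * P], so [O] would be nilpotent, although its trace [\dim H]
   is nonzero in characteristic 0. *)
- rewrite -ltnS (leq_trans _ le_ek) // ltnNge; apply/negP => le_e.
  have /submxP[u def_e] : (e <= e *m P)%MS.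
    have seP : (e *m P <= e)%MS by rewrite [e *m P]eP submxMl.
    by rewrite -(geq_leqif (mxrank_leqif_sup seP)).
  have e_eP : e = e * P.
    transitivity (u *m ((e * P) *m (e * P))); first by rewrite [X in u *m X]ePeP.
    by rewrite mulmxA -[u *m _]def_e -[LHS]/(e * (e * P)) mulrA ee.
  have Oj0 : O ^+ j * e = 0 by rewrite e_eP eP mulrA Op mul0r.
  have Oj1 : O ^+ j.+1 = 0 by rewrite exprSr -[X in _ * X]Oe -eO mulrA Oj0 mul0r.
  by have := mxtrace_nilpotent Oj1; rewrite trO => /eqP; rewrite natr_eq0 (negPf nzH).
- move=> z Gz; apply/commr_sym/commrM; first exact/commr_sym/eG.
  exact/comP/commr_sym/GO.
- by rewrite mulmxA ce.
Qed.

End Casimir.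

(** * Leibniz algebras *)

Section TracePairing.
Variables (F : fieldType) (n : nat).
Implicit Types (x y : 'M[F]_n.+1) (U V : {vspace 'M[F]_n.+1}).

Definition trace_pairing V x : 'rV[F]_(\dim V) := \row_i \tr (x * (vbasis V)`_i).

Fact trace_pairing_is_linear V : linear (trace_pairing V).
Proof.
by move=> a u v; apply/rowP => i; rewrite !mxE mulrDl -scalerAl mxtraceD mxtraceZ.
Qed.
HB.instance Definition _ V := GRing.isLinear.Build F 'M[F]_n.+1 'rV[F]_(\dim V) _
  (trace_pairing V) (trace_pairing_is_linear V).

Definition trace_orthv V : {vspace 'M[F]_n.+1} := lker (linfun (trace_pairing V)).

Lemma trace_orthvP V x :
  reflect (forall y, y \in V -> \tr (x * y) = 0) (x \in trace_orthv V).
Proof.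
rewrite memv_ker lfunE /=; apply: (iffP eqP) => [/rowP xV y /coord_vbasis->|xV].
  rewrite mulr_sumr raddf_sum big1 // => i _ /=; rewrite -scalerAr mxtraceZ.
  by have := xV i; rewrite !mxE => ->; rewrite mulr0.
by apply/rowP => i; rewrite !mxE xV // vbasis_mem ?mem_nth ?size_tuple.
Qed.

(** The pairing with [V] is injective on [U] and takes values in a space of dimension [\dim V]. *)
Lemma dim_trace_separated U V : (U :&: trace_orthv V)%VS = 0%VS ->
  (\dim U <= \dim V)%N.
Proof.
move/limg_dim_eq <-; apply: leq_trans (dimvS (subvf _)) _.
by rewrite dimvf -[X in (X <= _)%N]/(1 * \dim V)%N mul1n.
Qed.

End TracePairing.

Section Ideals.
Variables (F : fieldType) (L : vectType F) (mul : {bilinear L -> L -> L}).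
Implicit Types (R U V : {vspace L}).
Local Notation ideal := (leibniz_ideal mul).

Lemma leibniz_idealf : ideal fullv.
Proof. by split; apply: memvf. Qed.

(** Left multiplications are derivations; for right ones, [(u v) x = u (v x) - v (u x)]. *)
Lemma leibniz_ideal_prod R : left_leibniz mul -> ideal R -> ideal (lprodv mul R R).
Proof.
move=> leib idR; set D := lprodv mul R R.
have prodR u v : u \in R -> v \in R -> mul u v \in D by apply: memv_lprodv.
have left_mul x : (D <= linfun (mul x) @^-1: D)%VS.
  apply/lprodvP => u v Ru Rv; rewrite -memv_preim lfunE /= leib.
  by rewrite memvD ?prodR //; case: (idR x _ Ru); case: (idR x _ Rv).
have right_mul x : (D <= linfun (applyr mul x) @^-1: D)%VS.
  apply/lprodvP => u v Ru Rv; rewrite -memv_preim lfunE /=.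
  have -> : mul (mul u v) x = mul u (mul v x) - mul v (mul u x) by rewrite leib addrK.
  by rewrite memvB ?prodR //; case: (idR x _ Ru); case: (idR x _ Rv).
move=> x u Du; split.
  by have := subvP (left_mul x) u Du; rewrite -memv_preim lfunE.
by have := subvP (right_mul x) u Du; rewrite -memv_preim lfunE.
Qed.

Lemma derived_series_decreasing R k : ideal R ->
  (derived_series mul R k.+1 <= derived_series mul R k)%VS.
Proof.
move=> idR; elim: k => [|k IHk]; last exact: lprodvS.
by apply/lprodvP => u v Ru Rv; have [] := idR u v Rv.
Qed.

End Ideals.

(** * Representations and trace-orthogonal ideals *)

Section Representation.
Variables (F : fieldType) (L : vectType F) (mul : {bilinear L -> L -> L}) (n : nat).
Implicit Types (R U V : {vspace L}) (rho : 'Hom(L, 'M[F]_n.+1)).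
Local Notation ideal := (leibniz_ideal mul).

Definition representation rho :=
  forall x y, rho (mul x y) = commutator (rho x) (rho y).

Lemma limg_lprodv rho U V : representation rho ->
  (rho @: lprodv mul U V)%VS = lprodv (@commutator _ _) (rho @: U) (rho @: V).
Proof.
move=> repr; apply/eqP; rewrite eqEsubv; apply/andP; split.
  apply/subvP => _ /memv_imgP[z UVz ->]; rewrite memv_preim.
  apply: (subvP _ z UVz); apply/lprodvP => u v Uu Vv.
  by rewrite -memv_preim repr memv_lprodv ?memv_img.
apply/lprodvP => _ _ /memv_imgP[u Uu ->] /memv_imgP[v Vv ->].
by rewrite /= -repr memv_img // memv_lprodv.
Qed.

Lemma representation_idem rho e : representation rho -> e * e = e ->
    (forall x, GRing.comm e (rho x)) -> representation (amull e \o rho)%VF.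
Proof.
by move=> repr ee erho x y; rewrite !comp_lfunE !lfunE /= repr -commutatorM_idem.
Qed.

(** Pulled back to [L], so that it can be an ideal there; for [R = R'] it is the radical of the
    trace form on [R]. *)
Definition ideal_orth rho R R' : {vspace L} :=
  (R :&: rho @^-1: trace_orthv (rho @: R'))%VS.

Lemma ideal_orthP rho R R' x :
  reflect (x \in R /\ forall y, y \in R' -> \tr (rho x * rho y) = 0)
    (x \in ideal_orth rho R R').
Proof.
rewrite memv_cap -memv_preim; apply: (iffP andP) => -[Rx xR']; split=> //.
  by move=> y R'y; apply: (trace_orthvP _ _ xR'); rewrite memv_img.
by apply/trace_orthvP => _ /memv_imgP[y R'y ->]; apply: xR'.
Qed.

(** By invariance [tr ([rho u, rho x] rho y) = tr (rho u rho (x y))], and [x y] stays in [R']. *)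
Lemma leibniz_ideal_orth rho R R' : representation rho -> ideal R -> ideal R' ->
  ideal (ideal_orth rho R R').
Proof.
move=> repr idR idR' x u /ideal_orthP[Ru uR']; have [Rxu Rux] := idR x u Ru.
have trux y : y \in R' -> \tr (commutator (rho u) (rho x) * rho y) = 0.
  by move=> R'y; rewrite mxtrace_commutator -repr uR' //; case: (idR' x y R'y).
split; apply/ideal_orthP; split=> // y R'y; last by rewrite repr trux.
by rewrite repr -[commutator _ _]opprB mulNr raddfN /= -/(commutator _ _) trux ?oppr0.
Qed.

End Representation.

(** * Images of ideals of a semisimple algebra *)

Section SemisimpleRepresentation.
Variables (F : fieldType) (L : vectType F) (mul : {bilinear L -> L -> L}) (n : nat).
Variable rho : 'Hom(L, 'M[F]_n.+1).
Hypothesis charF0 : [pchar F] =i pred0.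
Hypothesis leibnizL : left_leibniz mul.
Hypothesis rho_repr : representation mul rho.
(** The two properties of left multiplication used below: its kernel annihilates [L] from the left,
    and by semisimplicity solvable ideals lie in the Leibniz kernel and so act by zero. *)
Hypothesis rho_kerl : forall x y, rho x = 0 -> mul x y = 0.
Hypothesis rho_solvable :
  forall R, leibniz_ideal mul R -> leibniz_solvable mul R -> forall x, x \in R -> rho x = 0.
Implicit Types R : {vspace L}.
Local Notation ideal := (leibniz_ideal mul).

(** One step past [k], every product has a left factor killed by [rho], so it is zero. *)
Lemma solvable_of_rho_derived R k : (derived_series mul R k <= lker rho)%VS ->
  leibniz_solvable mul R.
Proof.
move=> Rk0; exists k.+1; apply/eqP; rewrite -subv0; apply/lprodvP => u v Ru _.
by rewrite rho_kerl ?mem0v //; apply/eqP; rewrite -memv_ker (subvP Rk0).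
Qed.

(** The images of the derived series stabilize at a perfect Lie algebra with zero trace form, which
    is zero by Cartan's criterion; hence [R] is solvable. *)
Lemma trace0_ideal R : ideal R ->
    (forall x y, x \in R -> y \in R -> \tr (rho x * rho y) = 0) ->
  forall x, x \in R -> rho x = 0.
Proof.
move=> idR trR; apply: rho_solvable => //.
pose D k := derived_series mul R k.
have decD k : (D k.+1 <= D k)%VS by apply: derived_series_decreasing.
have sDR k : (D k <= R)%VS.
  by elim: k => [|k IHk]; [exact: subvv | exact: subv_trans (decD k) IHk].
have [k Dk] := @descending_chain_stable _ _ (fun k => rho @: D k)%VS (fun k => limgS _ (decD k)).
apply: (@solvable_of_rho_derived _ k); rewrite lkerE; apply/eqP.
apply: cartan_perfect => //; first by rewrite -(limg_lprodv _ _ rho_repr).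
move=> _ _ /memv_imgP[u Du ->] /memv_imgP[v Dv ->].
by rewrite trR // (subvP (sDR k)).
Qed.

(** The orthogonal [X] of [R R] in [R] has zero image, so the pairing with [rho (R R)] is injective
    on [rho R], and the dimensions agree. *)
Lemma limg_ideal_prod R : ideal R -> (rho @: lprodv mul R R = rho @: R)%VS.
Proof.
move=> idR; have idD := leibniz_ideal_prod leibnizL idR.
have sDR : (lprodv mul R R <= R)%VS := derived_series_decreasing 0 idR.
apply/eqP; rewrite eqEdim limgS //=; apply: dim_trace_separated.
set X := ideal_orth rho R (lprodv mul R R).
have idX : ideal X by apply: leibniz_ideal_orth.
(* By invariance [x y] lies in the radical of [R], where [rho] vanishes. So [rho] kills [X X], and
   [X] is solvable. *)
have X_abelian x y : x \in X -> y \in R -> rho (mul x y) = 0.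
  move=> /ideal_orthP[Rx xD] Ry; have [_ Rxy] := idR y x Rx.
  apply: (@trace0_ideal (ideal_orth rho R R)); first exact: leibniz_ideal_orth.
    by move=> u v /ideal_orthP[Ru uR] /ideal_orthP[Rv _]; apply: uR.
  apply/ideal_orthP; split=> // z Rz.
  by rewrite rho_repr mxtrace_commutator -rho_repr xD // memv_lprodv.
have X0 : forall x, x \in X -> rho x = 0.
  apply: rho_solvable => //; apply: (@solvable_of_rho_derived _ 1).
  apply/lprodvP => x y Xx /ideal_orthP[Ry _]; rewrite memv_ker.
  by apply/eqP; apply: X_abelian.
apply/eqP; rewrite -subv0; apply/subvP => _ /memv_capP[/memv_imgP[x Rx ->]].
move=> /trace_orthvP xD; rewrite X0 ?mem0v //; apply/ideal_orthP; split=> // y Dy.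
by apply: xD; apply: memv_img.
Qed.

(** The radical of the trace form of [sigma = e rho] is an ideal of [L]. Its image under [rho] is
    perfect, hence so is its image under [sigma], which Cartan's criterion makes zero. *)
Lemma trace_form_nondegenerate e : e * e = e -> (forall x, GRing.comm e (rho x)) ->
  forall z, z \in (amull e @: limg rho)%VS ->
    (forall y, y \in (amull e @: limg rho)%VS -> \tr (z * y) = 0) -> z = 0.
Proof.
move=> ee erho; have srepr := representation_idem rho_repr ee erho.
rewrite -limg_comp; set sigma := (_ \o rho)%VF in srepr *.
move=> _ /memv_imgP[x _ ->] orth_x.
set R := ideal_orth sigma fullv fullv.
have idR : ideal R by apply: leibniz_ideal_orth => //; apply: leibniz_idealf.
have R0 : (sigma @: R = 0)%VS.
  apply: cartan_perfect => //.
    by rewrite -(limg_lprodv _ _ srepr) limg_comp limg_ideal_prod // -limg_comp.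
  move=> _ _ /memv_imgP[u /ideal_orthP[_ uR] ->] /memv_imgP[v _ ->].
  by rewrite uR ?memvf.
apply/eqP; rewrite -memv0 -R0 memv_img //; apply/ideal_orthP.
by split=> [|y _]; rewrite ?memvf // orth_x // memv_img ?memvf.
Qed.

Lemma limg_lie x y : x \in limg rho -> y \in limg rho -> commutator x y \in limg rho.
Proof.
by move=> /memv_imgP[u _ ->] /memv_imgP[v _ ->]; rewrite -rho_repr memv_img ?memvf.
Qed.

Lemma invariant_row_eq0 (c : 'rV[F]_n.+1) : (forall x, c *m rho x = 0) ->
    (forall e, (forall x, rho x * e = 0) -> c *m e = 0) ->
  c = 0.
Proof.
move=> cG c_span; apply: (invariant_in_span_eq0 (G := limg rho)) => //.
- exact: limg_lie.
- move=> e ee eG; apply: trace_form_nondegenerate => // x.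
  by apply: eG; rewrite memv_img ?memvf.
- by move=> _ /memv_imgP[x _ ->].
by move=> e Ge; apply: c_span => x; rewrite Ge ?memv_img ?memvf.
Qed.

(** [rho c] commutes with [rho L], so [c] lies in the preimage of the centralizer; the products
    within this ideal are killed by [rho]. *)
Lemma right_center_solvable c : right_center mul c ->
  exists R, [/\ leibniz_ideal mul R, leibniz_solvable mul R & c \in R].
Proof.
move=> mulc; exists (rho @^-1: 'C(limg rho))%VS.
have CP x : reflect (forall y, commutator (rho y) (rho x) = 0)
    (x \in (rho @^-1: 'C(limg rho))%VS).
  rewrite -memv_preim; apply: (iffP centvP) => [xC y|xC _ /memv_imgP[y _ ->]].
    by rewrite /commutator xC ?subrr // memv_img ?memvf.
  by apply/eqP; rewrite eq_sym -subr_eq0; apply/eqP/xC.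
split.
- move=> x u /CP uC; split; apply/CP => y; rewrite rho_repr.
    by rewrite uC /commutator mulr0 mul0r subrr.
  by rewrite -[commutator (rho u) _]opprB -/(commutator _ _) uC oppr0
             /commutator mulr0 mul0r subrr.
- apply: (@solvable_of_rho_derived _ 1); apply/lprodvP => u v _ /CP vC.
  by rewrite memv_ker rho_repr vC.
by apply/CP => y; rewrite -rho_repr mulc linear0.
Qed.

End SemisimpleRepresentation.

(** * The left multiplication representation and the conclusion *)

Lemma vector_coordinates (F : fieldType) (L : vectType F) :
  exists n (f : 'Hom(L, 'rV[F]_n)) (g : 'Hom('rV[F]_n, L)),
    cancel f g /\ cancel g f.
Proof.
have basisL := vbasisP {:L}%VS.
exists (\dim {:L}), (linfun (rVof (vbasis {:L}))), (linfun (vecof (vbasis {:L}))).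
by split=> x; rewrite !lfunE /= ?rVofK ?vecofK.
Qed.

(* The sign turns the antihomomorphism given by row vectors into a representation. *)
Section LeftMultiplication.
Variables (F : fieldType) (L : vectType F) (mul : {bilinear L -> L -> L}) (n : nat).
Variables (f : 'Hom(L, 'rV[F]_n.+1)) (g : 'Hom('rV[F]_n.+1, L)).
Hypotheses (fK : cancel f g) (gK : cancel g f).

Definition left_mul_mx x : 'M[F]_n.+1 := - lin1_mx (f \o mul x \o g).

Fact left_mul_mx_is_linear : linear left_mul_mx.
Proof.
move=> a x y; apply/matrixP => i j.
by rewrite !mxE /= linearDl linearZl_LR /= !linearD !linearZ /= !mxE opprD mulrN.
Qed.
HB.instance Definition _ := GRing.isLinear.Build F L 'M[F]_n.+1 _ left_mul_mx
  left_mul_mx_is_linear.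

Lemma left_mul_mxE x y : f (mul x y) = - (f y *m left_mul_mx x).
Proof. by rewrite mulmxN opprK mul_rV_lin1 /= fK. Qed.

Lemma left_mul_mx_eq0 x : (forall y, mul x y = 0) -> left_mul_mx x = 0.
Proof.
move=> x0; apply/row_matrixP => i; rewrite row0 rowE -[delta_mx 0 i]gK.
by apply: oppr_inj; rewrite -left_mul_mxE x0 linear0 oppr0.
Qed.

Lemma left_mul_mx_repr : left_leibniz mul -> representation mul (linfun left_mul_mx).
Proof.
move=> leib x y; rewrite !lfunE; apply/row_matrixP => i.
rewrite 2!rowE -[delta_mx 0 i]gK; apply: oppr_inj; rewrite -left_mul_mxE.
have -> : mul (mul x y) (g (delta_mx 0 i)) =
    mul x (mul y (g (delta_mx 0 i))) - mul y (mul x (g (delta_mx 0 i))).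
  by rewrite leib addrK.
rewrite linearB /= !left_mul_mxE !mulNmx !opprK /commutator mulmxBr opprB.
by rewrite -!mulmxA.
Qed.

End LeftMultiplication.

(** Squares annihilate from the left, because [z (z y) = (z z) y + z (z y)]. *)
Lemma leibniz_kernel_mul0 (F : fieldType) (L : vectType F)
    (mul : {bilinear L -> L -> L}) x y :
  left_leibniz mul -> leibniz_kernel mul x -> mul x y = 0.
Proof.
move=> leib [s]; suffices sub : (<<[seq mul z z | z <- s]>> <= lker (linfun (applyr mul y)))%VS.
  by move/(subvP sub); rewrite memv_ker lfunE => /eqP.
apply/span_subvP => _ /mapP[z _ ->]; rewrite memv_ker lfunE /=.
by apply/eqP; apply: (addIr (mul z (mul z y))); rewrite add0r -leib.
Qed.

Theorem proposition4p2 (F : fieldType) (charF0 : [pchar F] =i pred0)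
  (L : vectType F) (mul : {bilinear L -> L -> L})
  (leibnizL : left_leibniz mul) (semisimpleL : leibniz_semisimple mul) :
  forall c : L, right_center mul c <-> c = 0.
Proof.
move=> c; split=> [mulc|-> x]; last exact: linear0r.
(* The matrices have size [n.+1], so the zero algebra is treated apart. *)
have [[|n] [f [g [fK gK]]]] := vector_coordinates L.
  by apply: (can_inj fK); rewrite [LHS]thinmx0 linear0.
pose rho := linfun (left_mul_mx mul f g).
have rhoE x y : f (mul x y) = - (f y *m rho x) by rewrite lfunE (left_mul_mxE _ fK).
apply: (can_inj fK); rewrite linear0.
apply: (@invariant_row_eq0 F L mul n rho) => //.
- exact: left_mul_mx_repr.
- by move=> x y x0; apply: (can_inj fK); rewrite rhoE x0 mulmx0 oppr0 linear0.
- move=> R idR solR x Rx; rewrite lfunE; apply: (left_mul_mx_eq0 fK gK) => y.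
  exact: leibniz_kernel_mul0 (semisimpleL R idR solR x Rx).
- by move=> x; apply: oppr_inj; rewrite -rhoE mulc linear0 oppr0.
(* [c] lies in a solvable ideal, hence is a combination of squares; [z z] has coordinates
   [- (f z *m rho z)], which [e] kills. *)
move=> e rho_e; have [||R [idR solR Rc]] := @right_center_solvable F L mul n rho _ _ c mulc.
- exact: left_mul_mx_repr.
- by move=> x y x0; apply: (can_inj fK); rewrite rhoE x0 mulmx0 oppr0 linear0.
have [s] := semisimpleL R idR solR c Rc.
suffices sub : (<<[seq mul z z | z <- s]>> <= lker (linfun (mulmxr e) \o f))%VS.
  by move/(subvP sub); rewrite memv_ker comp_lfunE lfunE => /eqP.
apply/span_subvP => _ /mapP[z _ ->]; rewrite memv_ker comp_lfunE lfunE /=.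
by rewrite rhoE mulNmx -mulmxA [rho z *m e]rho_e mulmx0 oppr0.
Qed.
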